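(* Let $q$, $\Xi=\{\xi_j\}_{j\ge0}$, $S=\{s_j\}_{j\ge0}$ be generic nonzero complex parameters and $\bar\Xi=\{\xi_j^{-1}\}_{j\ge0}$. Let $u,v\in\mathbb C$ satisfy $$\lim_{L\to+\infty}\prod_{j=0}^{L}\left|\frac{\xi_ju-s_j}{1-s_j\xi_ju}\cdot\frac{\xi_j^{-1}v-s_j}{1-s_j\xi_j^{-1}v}\right|=0.$$ Then for any $\lambda,\nu\in\mathrm{Sign}^+$, $$\sum_{\kappa\in\mathrm{Sign}^+}G^c_{\kappa/\lambda}(v\,|\,\bar\Xi,S)\,F_{\kappa/\nu}(u\,|\,\Xi,S)=\frac{1-quv}{1-uv}\sum_{\mu\in\mathrm{Sign}^+}F_{\lambda/\mu}(u\,|\,\Xi,S)\,G^c_{\nu/\mu}(v\,|\,\bar\Xi,S).$$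
   Context: $\mathrm{Sign}_N^+$ is the set of integer sequences $\lambda_1\ge\dots\ge\lambda_N\ge0$ ($\mathrm{Sign}_0^+=\{\varnothing\}$), and $\mathrm{Sign}^+=\bigsqcup_{N\ge0}\mathrm{Sign}_N^+$. For $\lambda\in\mathrm{Sign}^+$ let $m_x(\lambda)$ be the number of parts equal to $x$. $(z;q)_m=\prod_{i=0}^{m-1}(1-zq^i)$. ''Generic'' means that no denominators occurring in the formulas vanish. Vertex weights: for $g\in\mathbb Z_{\ge0}$, $w_{u,s}(g,0;g,0)=\frac{1-sq^gu}{1-su}$, $w_{u,s}(g+1,0;g,1)=\frac{(1-s^2q^g)u}{1-su}$, $w_{u,s}(g,1;g,1)=\frac{u-sq^g}{1-su}$, $w_{u,s}(g,1;g+1,0)=\frac{1-q^{g+1}}{1-su}$; all other $w_{u,s}(i_1,j_1;i_2,j_2)$ are $0$. One-variable functions: for $\lambda,\mu\in\mathrm{Sign}_N^+$, $G_{\mu/\lambda}(u\,|\,\Xi,S)=\prod_{x\ge0}w_{\xi_xu,s_x}(m_x(\lambda),h_x;m_x(\mu),h_{x+1})$, where $h_0=0$ and $h_{x+1}=m_x(\lambda)+h_x-m_x(\mu)$; it is $0$ if some $h_x\notin\{0,1\}$, or if $\lambda,\mu$ have different lengths. For $\lambda\in\mathrm{Sign}_N^+$, $\mu\in\mathrm{Sign}_{N+1}^+$, $F_{\mu/\lambda}(u\,|\,\Xi,S)$ is given by the same product with $h_0=1$ instead; it is $0$ if the length of $\mu$ is not the length of $\lambda$ plus one. (These are partition functions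 of collections of up-right lattice paths in one horizontal row; since $h_x=0$ for large $x$, only finitely many factors differ from $1$.) $c_S(\nu)=\prod_{x\ge0}\frac{(s_x^2;q)_{m_x(\nu)}}{(q;q)_{m_x(\nu)}}$ and $G^c_{\lambda/\mu}=\frac{c_S(\lambda)}{c_S(\mu)}G_{\lambda/\mu}$. The identity is nontrivial only if $\nu\in\mathrm{Sign}_N^+$ and $\lambda\in\mathrm{Sign}_{N+1}^+$ for some $N$. In this case the sum on the right is over $\mu\in\mathrm{Sign}_N^+$ and is finite, while the sum on the left is over $\kappa\in\mathrm{Sign}_{N+1}^+$ and is infinite, but converges due to the assumed condition on $u,v$.
   Formalization: If some factor of the product in the limit condition vanishes (ξ_j u = s_j or ξ_j^{-1}v = s_j), the product over later indices is also assumed to tend to 0, since the identity can fail otherwise; the sum over κ is the limit of sums over κ of bounded length and bounded parts. *)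

(* Defs.v *)
From HB Require Import structures.
From mathcomp Require Import all_boot all_order all_algebra.
From mathcomp Require Import all_classical all_reals all_analysis.
From mathcomp Require Import complex.

Set Implicit Arguments.
Unset Strict Implicit.
Unset Printing Implicit Defensive.

Import Order.TTheory GRing.Theory Num.Theory.
Import numFieldNormedType.Exports.

Local Open Scope classical_set_scope.
Local Open Scope ring_scope.

Definition signature : Type := {s : seq nat | sorted geq s}.
HB.instance Definition _ := Choice.on signature.

Definition len (la : signature) : nat := size (val la).

Definition mult (x : nat) (la : signature) : nat := count_mem x (val la).

Definition sign_box (N L : nat) : set signature :=
  [set la | (len la <= N)%N /\ all (fun x => x <= L)%N (val la)].

Lemma finite_sign_box (N L : nat) : finite_set (sign_box N L).
Proof.
apply: (@sub_finite_set _ _ [set` pmap (insub : seq nat -> option signature)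
    [seq [seq val i | i <- (t : seq 'I_L.+1)]
       | t <- flatten [seq [seq val t | t : n.-tuple 'I_L.+1]
                         | n <- iota 0 N.+1]]]); last exact: finite_seq.
move=> la [laN laL]; rewrite /mkset mem_pmap.
apply/mapP; exists (val la); last by rewrite valK.
have valE : [seq val i | i <- [seq inord x : 'I_L.+1 | x <- val la]] = val la.
  rewrite -map_comp; apply: map_id_in => x xla /=.
  by rewrite inordK// ltnS (allP laL).
rewrite -{1}valE; apply: map_f; apply/flattenP.
exists [seq val t | t : (len la).-tuple 'I_L.+1].
  by apply/mapP; exists (len la); rewrite // mem_iota add0n ltnS laN.
have sz : size [seq inord x : 'I_L.+1 | x <- val la] == len la.
  by rewrite size_map.
by apply/mapP; exists (Tuple sz) => //; rewrite mem_enum.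
Qed.

(* An infinite sum over all signatures is the limit of its finite partial sums
   over the boxes sign_box N L, as N and L tend to infinity independently.
   Summation over kappa in the Cauchy identity is in general only conditionally
   convergent (its terms are differences of consecutive partial products of a
   complex product tending to 0), so the exhaustion has to be specified. *)
Definition sign_series (R : realType) (f : signature -> R[i]%C) (l : R[i]%C) :
    Prop :=
  (\sum_(la \in sign_box p.1 p.2) f la) @[p --> (\oo, \oo)]
    --> (l : (R[i]%C)^o).

Section Weights.
Variable C : fieldType.
Implicit Types (q z u s : C) (Xi S : nat -> C) (la mu nu : signature).

Definition qpoch z q (m : nat) : C := \prod_(i < m) (1 - z * q ^+ i).

Definition weight q u s (i1 : nat) (j1 : int) (i2 : nat) (j2 : int) : C :=
  if [&& j1 == 0, j2 == 0 & i2 == i1] then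
    (1 - s * q ^+ i1 * u) / (1 - s * u)
  else if [&& j1 == 0, j2 == 1 & i1 == i2.+1] then
    (1 - s ^+ 2 * q ^+ i2) * u / (1 - s * u)
  else if [&& j1 == 1, j2 == 1 & i2 == i1] then
    (u - s * q ^+ i1) / (1 - s * u)
  else if [&& j1 == 1, j2 == 0 & i2 == i1.+1] then
    (1 - q ^+ i1.+1) / (1 - s * u)
  else 0.

Fixpoint hedge (h0 : int) mu la (x : nat) : int :=
  if x is y.+1 then (mult y la)%:Z + hedge h0 mu la y - (mult y mu)%:Z
  else h0.

(* The product over all x : nat is a finitely supported one: when mu has h0
   more parts than la, the factors equal 1 beyond the largest part, as long as
   the denominators do not vanish. *)
Definition row_weight (h0 : int) q Xi S u mu la : C :=
  let h := hedge h0 mu la in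
  if `[< forall x, h x = 0 \/ h x = 1 >] then
    \big[*%R/1]_(x \in [set: nat])
      weight q (Xi x * u) (S x) (mult x la) (h x) (mult x mu) (h x.+1)
  else 0.

Definition G q Xi S u mu la : C :=
  if len mu == len la then row_weight 0 q Xi S u mu la else 0.

Definition F q Xi S u mu la : C :=
  if len mu == (len la).+1 then row_weight 1 q Xi S u mu la else 0.

Definition c q S nu : C :=
  \big[*%R/1]_(x \in [set: nat])
    (qpoch (S x ^+ 2) q (mult x nu) / qpoch q q (mult x nu)).

Definition Gc q Xi S u la mu : C := c q S la / c q S mu * G q Xi S u la mu.

(* A vanishing ratio at a single column j makes the product over all columns 0
   without any decay in the columns beyond j, where the sum over kappa still
   has nonzero terms if la, nu have suitable parts (e.g. Xi 0 * u = S 0,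
   nu = (0), la = (0, 0)). In that non-generic case the decay of the product
   beyond j has to be required separately. *)
Definition column_ratio Xi S u (v : C) (j : nat) : C :=
  (Xi j * u - S j) / (1 - S j * Xi j * u) *
  (((Xi j)^-1 * v - S j) / (1 - S j * (Xi j)^-1 * v)).

End Weights.

(* Main.v *)
(** Each side of the identity is a partition function of two rows of paths, so
it can be computed column by column. Let the state at column [x] be the pair
[(h, k)] of edges entering it in the [F]-row and in the [G]-row. With [la] and
[nu] fixed, summing over the multiplicity of [x] in [kappa], resp. in [mu],
gives a transfer matrix [T_x], resp. [T'_x], on the four states, and the two
sides are the limits of the [(0, 0)] entries of the row vectors
[l_L = e_(1,0) T_0 ... T_(L-1)] and [r_L = e_(1,0) T'_0 ... T'_(L-1)].

The Yang-Baxter equation is [T_x A = A T'_x] for a matrix [A] that depends on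
[u] and [v] only through [u v], hence not on [x]. As [e_(1,0)] is an
eigenvector of [A], with eigenvalue [1 - q u v], we get [l_L A =
(1 - q u v) r_L], whose [(0, 0)] entry reads
[(1 - u v) l_L(0,0) + (1 - q) l_L(1,1) = (1 - q u v) r_L(0,0)]. Beyond the
largest parts of [la] and [nu] the number [r_L(0,0)] is constant, and
[l_L(1,1)] is multiplied at each step by the ratio whose products are assumed
to tend to [0]. *)
Require Import Defs.
From mathcomp Require Import all_boot all_order all_algebra.
From mathcomp Require Import all_classical all_reals all_analysis.
From mathcomp Require Import complex ring zify.
Import Order.TTheory GRing.Theory Num.Theory.
Import numFieldNormedType.Exports.
Local Open Scope classical_set_scope.
Local Open Scope ring_scope.

Set Implicit Arguments.
Unset Strict Implicit.
Unset Printing Implicit Defensive.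

(** * Vertex weights and their sums over one multiplicity *)

(** Boolean edges make the set of states a finite type. *)
Definition vertex {C : fieldType} (q u s : C) (i1 : nat) (j1 : bool)
    (i2 : nat) (j2 : bool) : C :=
  weight q u s i1 (Posz j1) i2 (Posz j2).

(** The contribution of one column to [c]. *)
Definition mult_factor {C : fieldType} (q s : C) (m : nat) : C :=
  qpoch (s ^+ 2) q m / qpoch q q m.

Lemma sum_pair_bool (V : nmodType) (f : bool * bool -> V) :
  \sum_t f t =
  f (true, true) + f (true, false) + (f (false, true) + f (false, false)).
Proof.
transitivity (\sum_(h : bool) \sum_(k : bool) f (h, k)).
  by rewrite pair_big; apply: eq_bigr => -[].
by rewrite !big_bool.
Qed.

Lemma big_ord_single (V : nmodType) (n k : nat) (f : nat -> V) : (k < n)%N ->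
  (forall m, m != k -> f m = 0) -> \sum_(m < n) f m = f k.
Proof.
move=> kn f0; rewrite (bigD1 (Ordinal kn)) //= big1 ?addr0 // => i ik.
exact: f0.
Qed.

(** Conservation of paths leaves only the term [m = a + h - h'], if this is a natural number. The
    bound [a < M] keeps [a + 1] in the range of summation. *)
Lemma sum_vertex_out (C : fieldType) (q s w : C) M a h h' (g : nat -> C) :
  (a < M)%N ->
  \sum_(m < M.+1) vertex q w s a h m h' * g m =
  match h, h' with
  | false, false => (1 - s * q ^+ a * w) / (1 - s * w) * g a
  | true, true => (w - s * q ^+ a) / (1 - s * w) * g a
  | true, false => (1 - q ^+ a.+1) / (1 - s * w) * g a.+1
  | false, true =>
      if a is a'.+1 then (1 - s ^+ 2 * q ^+ a') * w / (1 - s * w) * g a' else 0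
  end.
Proof.
move=> aM.
case: h h' => [] [].
- rewrite (big_ord_single (k := a)
    (f := fun m => vertex q w s a true m true * g m)) ?ltnS 1?ltnW //.
    by rewrite /vertex /weight /= eqxx.
  by move=> m /negbTE ma; rewrite /vertex /weight /= ma mul0r.
- rewrite (big_ord_single (k := a.+1)
    (f := fun m => vertex q w s a true m false * g m)) //.
    by rewrite /vertex /weight /= eqxx.
  by move=> m /negbTE ma; rewrite /vertex /weight /= ma mul0r.
- case: a aM => [|a] aM.
    by rewrite big1 // => i _; rewrite /vertex /weight /= mul0r.
  rewrite (big_ord_single (k := a)
    (f := fun m => vertex q w s a.+1 false m true * g m)); last 2 first.
    by rewrite ltnS; lia.
    move=> m /negbTE ma; rewrite /vertex /weight /= eqSS eq_sym ma.
    by rewrite mul0r.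
  by rewrite /vertex /weight /= eqxx.
- rewrite (big_ord_single (k := a)
    (f := fun m => vertex q w s a false m false * g m)) ?ltnS 1?ltnW //.
    by rewrite /vertex /weight /= eqxx.
  by move=> m /negbTE ma; rewrite /vertex /weight /= ma mul0r.
Qed.

(** Here conservation reads [m = b + h' - h]. *)
Lemma sum_vertex_in (C : fieldType) (q s w : C) M b h h' (g : nat -> C) :
  (b < M)%N ->
  \sum_(m < M.+1) vertex q w s m h b h' * g m =
  match h, h' with
  | false, false => (1 - s * q ^+ b * w) / (1 - s * w) * g b
  | true, true => (w - s * q ^+ b) / (1 - s * w) * g b
  | false, true => (1 - s ^+ 2 * q ^+ b) * w / (1 - s * w) * g b.+1
  | true, false =>
      if b is b'.+1 then (1 - q ^+ b) / (1 - s * w) * g b' else 0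
  end.
Proof.
move=> bM.
case: h h' => [] [].
- rewrite (big_ord_single (k := b)
    (f := fun m => vertex q w s m true b true * g m)) ?ltnS 1?ltnW //.
    by rewrite /vertex /weight /= eqxx.
  by move=> m /negbTE mb; rewrite /vertex /weight /= eq_sym mb mul0r.
- case: b bM => [|b] bM.
    by rewrite big1 // => i _; rewrite /vertex /weight /= mul0r.
  rewrite (big_ord_single (k := b)
    (f := fun m => vertex q w s m true b.+1 false * g m)); last 2 first.
    by rewrite ltnS; lia.
    move=> m /negbTE mb; rewrite /vertex /weight /= eqSS eq_sym mb.
    by rewrite mul0r.
  by rewrite /vertex /weight /= eqxx.
- rewrite (big_ord_single (k := b.+1)
    (f := fun m => vertex q w s m false b true * g m)) //.
    by rewrite /vertex /weight /= eqxx.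
  by move=> m /negbTE mb; rewrite /vertex /weight /= mb mul0r.
- rewrite (big_ord_single (k := b)
    (f := fun m => vertex q w s m false b false * g m)) ?ltnS 1?ltnW //.
    by rewrite /vertex /weight /= eqxx.
  by move=> m /negbTE mb; rewrite /vertex /weight /= eq_sym mb mul0r.
Qed.

(* An edge carries at most one path, so truncating the multiplicity [m] at any
   [M > a, b] loses no term. *)
Definition upper_transfer {C : fieldType} (q u v s : C) (M a b : nat)
    (t t' : bool * bool) : C :=
  \sum_(m < M.+1) mult_factor q s m / mult_factor q s b
    * vertex q u s a t.1 m t'.1 * vertex q v s b t.2 m t'.2.

Definition lower_transfer {C : fieldType} (q u v s : C) (M a b : nat)
    (t t' : bool * bool) : C :=
  \sum_(m < M.+1) mult_factor q s a / mult_factor q s m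
    * vertex q u s m t.1 b t'.1 * vertex q v s m t.2 a t'.2.

(* As [cross] involves only the product [u * v], it is the same in all columns,
   whose spectral parameters are [Xi x * u] and [(Xi x)^-1 * v]. *)
Definition cross {C : fieldType} (q u v : C) (t t' : bool * bool) : C :=
  match t, t' with
  | (true, false), (true, false) | (false, true), (false, true) =>
      1 - q * (u * v)
  | (false, false), (false, false) => 1 - u * v
  | (false, false), (true, true) => u * v * (1 - q)
  | (true, true), (false, false) => 1 - q
  | (true, true), (true, true) => q * (1 - u * v)
  | _, _ => 0
  end.

(** * The Yang-Baxter equation in one column *)

Section YangBaxter.
Variables (C : fieldType) (q u v s : C).
Hypotheses (Dq : forall i : nat, 1 - q ^+ i.+1 != 0)
  (DS : forall i : nat, 1 - s ^+ 2 * q ^+ i != 0)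
  (Du : 1 - s * u != 0) (Dv : 1 - s * v != 0).

Local Notation cf := (mult_factor q s).

Lemma mult_factor_neq0 m : cf m != 0.
Proof.
rewrite /mult_factor /qpoch mulf_neq0 ?invr_neq0 //; apply/prodf_neq0 => i _.
  exact: DS.
by rewrite -exprS.
Qed.

Lemma mult_factorS m :
  cf m.+1 = cf m * ((1 - s ^+ 2 * q ^+ m) / (1 - q ^+ m.+1)).
Proof.
rewrite /mult_factor /qpoch !big_ord_recr /= -exprS invfM.
by rewrite mulrACA.
Qed.

(** By conservation each sum over [m] has at most one term, so for each of the sixteen pairs of
    states there remains an identity of rational functions, left to [field]. *)
Lemma yang_baxter M a b (t t' : bool * bool) : (a < M)%N -> (b < M)%N ->
  \sum_r upper_transfer q u v s M a b t r * cross q u v r t' =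
  \sum_r cross q u v t r * lower_transfer q u v s M a b r t'.
Proof.
move=> aM bM.
have upE r1 r2 : upper_transfer q u v s M a b r1 r2 = \sum_(m < M.+1)
    vertex q u s a r1.1 m r2.1 * (cf m / cf b * vertex q v s b r1.2 m r2.2).
  by apply: eq_bigr => m _; rewrite mulrCA mulrA.
have loE r1 r2 : lower_transfer q u v s M a b r1 r2 = \sum_(m < M.+1)
    vertex q u s m r1.1 b r2.1 * (cf a / cf m * vertex q v s m r1.2 a r2.2).
  by apply: eq_bigr => m _; rewrite mulrCA mulrA.
rewrite !sum_pair_bool !upE !loE.
rewrite !(sum_vertex_out (a := a) q s u _ _
  (fun m => cf m / cf b * vertex q v s b _ m _)) //.
rewrite !(sum_vertex_in (b := b) q s u _ _
  (fun m => cf a / cf m * vertex q v s m _ a _)) //.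
move: a b {aM bM upE loE} => a b.
(* [z] and [k] become atoms for [field]. The multiplicities in one identity are close to each other,
   so three consecutive denominators of each kind suffice; at the boundary [n = 0] the value [z = 1]
   is needed. *)
have step n : exists z k,
  [/\ [/\ q ^+ n = z, cf n = k & n = 0%N -> z = 1], k != 0,
    [/\ 1 - q * z != 0, 1 - q * (q * z) != 0 & 1 - q * (q * (q * z)) != 0] &
    [/\ 1 - s ^+ 2 * z != 0, 1 - s ^+ 2 * (q * z) != 0
      & 1 - s ^+ 2 * (q * (q * z)) != 0]].
  exists (q ^+ n), (cf n); split; rewrite -?exprS ?mult_factor_neq0 //.
  by split => // ->.
case: t t' => [[] []] [[] []];
  rewrite /cross /vertex /weight /= ?mul0r ?mulr0 ?add0r ?addr0.
all: case: a => [|a]; case: b => [|b] //=.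
all: repeat match goal with |- context [@eq_op _ ?x ?y] =>
  case: (@eqP nat x y) => ?; try (exfalso; lia) end.
all: rewrite ?(mul0r, mulr0, add0r, addr0) //.
(* Write [t = (h, k)] and [t' = (h', k')]. Since [cross] preserves [h - k], a nonzero term forces
   [a - b = (h' - k') - (h - k)] for the original [a] and [b], which lies between -2 and 2. *)
all: match goal with
  | a : nat, b : nat |- _ => first
     [ have ? : a = b by lia | have ? : a = b.+1 by lia
     | have ? : b = a.+1 by lia | have ? : a = b.+2 by lia
     | have ? : b = a.+2 by lia ]; subst
  | a : nat |- _ => first
     [ have ? : a = 0%N by lia | have ? : a = 1%N by lia ]; subst
  | |- _ => idtac
  end.
all: rewrite ?mult_factorS ?(exprS q).
all: match goal with
  | |- context [q ^+ ?n] =>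
     have [z [k [[-> -> zE] k0 [q1 q2 q3] [s1 s2 s3]]]] := step n
  end.
all: try (have ? := zE erefl; subst z; rewrite ?mulr1 in q1 q2 q3 s1 s2 s3).
all: field; rewrite ?k0 ?q1 ?q2 ?q3 ?s1 ?s2 ?s3 ?Du ?Dv //.
Qed.

End YangBaxter.

(** * Signatures enumerated by their multiplicities *)

Definition parts_lt (L : nat) (la : signature) :=
  all (fun x => x < L)%N (val la).

Definition sig_nil : signature := exist _ [::] isT.

(** Intended for [L] above all parts of [la], where the result is sorted; an unsorted result is
    replaced by the default [sig_nil]. *)
Definition sig_add (m L : nat) (la : signature) : signature :=
  insubd sig_nil (nseq m L ++ val la).

(** The multiplicities range up to [M] independently, with no bound on the length, so that sums over
    this list factor over the columns. *)
Fixpoint enum_sig (M L : nat) : seq signature :=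
  if L is x.+1 then
    [seq sig_add m x la | m <- iota 0 M.+1, la <- enum_sig M x]
  else [:: sig_nil].

Lemma enum_sigS M L : enum_sig M L.+1 =
  [seq sig_add m L la | m <- iota 0 M.+1, la <- enum_sig M L].
Proof. by []. Qed.

Lemma parts_ltW L L' (la : signature) :
  (L <= L')%N -> parts_lt L la -> parts_lt L' la.
Proof. by move=> LL' /allP h; apply/allP => x /h xL; apply: leq_trans LL'. Qed.

Lemma ex_parts_lt (la : signature) : exists L, parts_lt L la.
Proof.
exists (\max_(x <- val la) x).+1; apply/allP => x xla.
by rewrite ltnS; exact: (@leq_bigmax_seq _ _ xpredT (fun y => y)).
Qed.

Lemma geq_trans : transitive geq.
Proof. by move=> y x z /= yx zy; apply: leq_trans yx. Qed.

Lemma sorted_nseq_cat m L (r : seq nat) :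
  sorted geq r -> all (fun x => x < L)%N r -> sorted geq (nseq m L ++ r).
Proof.
move=> rs rL; elim: m => //= m IH; rewrite (path_sortedE geq_trans) IH andbT.
rewrite all_cat; apply/andP; split.
  by apply/allP => x /nseqP[-> _] /=.
by apply/allP => x /(allP rL) /ltnW.
Qed.

Lemma val_sig_add m L (la : signature) :
  parts_lt L la -> val (sig_add m L la) = nseq m L ++ val la.
Proof.
move=> laL; rewrite /sig_add val_insubd sorted_nseq_cat //.
exact: (valP la).
Qed.

Lemma mult_sig_add m L (la : signature) x : parts_lt L la ->
  mult x (sig_add m L la) = ((x == L) * m + mult x la)%N.
Proof.
move=> laL; rewrite /mult val_sig_add // count_cat count_nseq /=.
by rewrite eq_sym.
Qed.

Lemma mult_ge L (la : signature) x :
  parts_lt L la -> (L <= x)%N -> mult x la = 0%N.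
Proof.
move=> /allP laL Lx; apply/count_memPn; apply/negP => /laL.
by rewrite ltnNge Lx.
Qed.

Lemma enum_sig_parts M L la : la \in enum_sig M L -> parts_lt L la.
Proof.
elim: L la => [|L IH] la; first by rewrite inE => /eqP ->.
rewrite enum_sigS; case/allpairsP => -[m mu] /= [_ /IH muL ->].
rewrite /parts_lt val_sig_add // all_cat; apply/andP; split.
  by apply/allP => x /nseqP[-> _].
exact: parts_ltW muL.
Qed.

(** Both sides are sorted permutations of each other once [mu] collects the parts of [la] below
    [L]. *)
Lemma sig_split L (la : signature) : parts_lt L.+1 la ->
  {mu | parts_lt L mu & la = sig_add (mult L la) L mu}.
Proof.
move=> laL; set r := [seq x <- val la | (x < L)%N].
have rs : sorted geq r by apply: sorted_filter (valP la); exact: geq_trans.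
have rL : parts_lt L (exist _ r rs) by rewrite /parts_lt /= filter_all.
exists (exist _ r rs) => //.
apply: val_inj; rewrite val_sig_add //=.
apply: (@sorted_eq _ geq geq_trans).
- by move=> x y /= /andP[yx xy]; apply/eqP; rewrite eqn_leq xy yx.
- exact: (valP la).
- exact: sorted_nseq_cat.
rewrite perm_sym perm_catC.
have -> : nseq (mult L la) L = [seq x <- val la | predC (fun y => y < L)%N x].
  have e : [seq x <- val la | predC (fun y => y < L)%N x]
      = [seq x <- val la | pred1 L x].
    apply: eq_in_filter => x /(allP laL) /=; rewrite ltnS => xL.
    by rewrite -leqNgt eqn_leq xL.
  rewrite e /mult -size_filter; apply/esym/all_pred1P.
  exact: filter_all.
by rewrite perm_filterC.
Qed.

Lemma mem_enum_sig M L (la : signature) :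
  parts_lt L la -> (len la <= M)%N -> la \in enum_sig M L.
Proof.
elim: L la => [|L IH] la laL laM.
  by case: la laL laM => -[|x r] ? //= _ _; rewrite inE; apply/eqP/val_inj.
have [mu muL e] := sig_split laL.
have := congr1 (fun s => size (val s)) e.
rewrite val_sig_add // size_cat size_nseq -!/(len _) => le.
rewrite e enum_sigS; apply/allpairsP; exists (mult L la, mu); split => //.
  rewrite -[_.1]/(mult L la) mem_iota add0n ltnS (leq_trans _ laM) //.
  by rewrite le leq_addr.
by apply: IH => //; apply: leq_trans laM; rewrite le leq_addl.
Qed.

Lemma enum_sig_uniq M L : uniq (enum_sig M L).
Proof.
elim: L => // L IH; rewrite enum_sigS.
apply: allpairs_uniq => //; first exact: iota_uniq.
move=> _ _ /allpairsP[[m la] [_ laM ->]] /allpairsP[[m' mu] [_ muM ->]] /=.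
move: laM muM => /= /enum_sig_parts laL /enum_sig_parts muL e.
have mm : m = m'.
  have := congr1 (mult L) e; rewrite !mult_sig_add // eqxx !mul1n.
  by rewrite !(@mult_ge L) // !addn0.
move: e; rewrite -mm => /(congr1 val); rewrite !val_sig_add //.
by move=> /eqP; rewrite eqseq_cat // eqxx => /eqP /val_inj ->.
Qed.

Lemma len_sum_mult L (la : signature) :
  parts_lt L la -> len la = (\sum_(x < L) mult x la)%N.
Proof.
elim: L la => [|L IH] la laL.
  by case: la laL => -[|x r] ? //= _; rewrite big_ord0.
have [mu muL e] := sig_split laL.
rewrite big_ord_recr /= {1}e /len val_sig_add // size_cat size_nseq addnC.
congr addn; rewrite -/(len mu) IH //; apply: eq_bigr => x _.
by rewrite e mult_sig_add // ltn_eqF.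
Qed.

(** * Products of transfer matrices *)

(** Entry [t] of the row vector [e_t0 w_0 ... w_(L-1)]. The state space is arbitrary because single
    rows use [bool] and pairs of rows use [bool * bool]. *)
Fixpoint transfer {C : pzSemiRingType} {T : finType} (w : nat -> T -> T -> C)
    (t0 : T) (L : nat) (t : T) : C :=
  if L is x.+1 then \sum_(t1 : T) transfer w t0 x t1 * w x t1 t
  else (t == t0)%:R.

Section Transfer.
Variables (C : comPzSemiRingType) (T : finType).

Lemma eq_transfer (w w' : nat -> T -> T -> C) t0 L t :
  (forall x, (x < L)%N -> w x =2 w' x) ->
  transfer w t0 L t = transfer w' t0 L t.
Proof.
elim: L t => //= L IH t ww'; apply: eq_bigr => t1 _.
by rewrite IH ?ww' // => x xL; apply: ww'; apply: ltnW.
Qed.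

(** Distributivity: multiplicities in distinct columns vary independently, so the sum can be taken
    inside the matrix of each column. *)
Lemma sum_enum_sig_transfer (w : nat -> nat -> T -> T -> C) t0 M L t :
  \sum_(la <- enum_sig M L) transfer (fun x => w x (mult x la)) t0 L t =
  transfer (fun x t t' => \sum_(m < M.+1) w x m t t') t0 L t.
Proof.
elim: L t => [|L IH] t; first by rewrite big_seq1.
rewrite enum_sigS big_allpairs_dep.
have e m : \sum_(la <- enum_sig M L)
      transfer (fun x => w x (mult x (sig_add m L la))) t0 L.+1 t =
    \sum_(la <- enum_sig M L) \sum_t1
      transfer (fun x => w x (mult x la)) t0 L t1 * w L m t1 t.
  apply: eq_big_seq => la /enum_sig_parts laL /=.
  apply: eq_bigr => t1 _.
  rewrite mult_sig_add // eqxx mul1n (@mult_ge L) // addn0.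
  congr (_ * _); apply: eq_transfer => x xL t2 t3.
  by rewrite mult_sig_add // ltn_eqF.
under eq_bigr => m _ do rewrite e exchange_big /=.
rewrite exchange_big /=; apply: eq_bigr => t1 _.
rewrite -IH big_distrl exchange_big /=; apply: eq_bigr => la _.
rewrite -big_distrr /= -(big_mkord xpredT (fun m => w L m t1 t)).
by rewrite /index_iota subn0.
Qed.

(** [A] is pulled to the left one column at a time, turning each [w x] into [w' x], until it meets
    its left eigenvector at [t0]. *)
Lemma transfer_intertwine (w w' : nat -> T -> T -> C) (A : T -> T -> C)
    alpha t0 L t' :
  (forall x t t', \sum_r w x t r * A r t' = \sum_r A t r * w' x r t') ->
  (forall t, A t0 t = alpha * (t == t0)%:R) ->
  \sum_t transfer w t0 L t * A t t' = alpha * transfer w' t0 L t'.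
Proof.
move=> wA A0; elim: L t' => [|L IH] t' /=.
  rewrite (bigD1 t0) //= eqxx mul1r A0 big1 ?addr0 // => t /negbTE ->.
  by rewrite mul0r.
under eq_bigr => t _ do rewrite big_distrl /=.
rewrite exchange_big /= big_distrr /=.
transitivity (\sum_t1 \sum_r transfer w t0 L t1 * A t1 r * w' L r t').
  apply: eq_bigr => t1 _; under [RHS]eq_bigr => r _ do rewrite -mulrA.
  rewrite -big_distrr -wA big_distrr; apply: eq_bigr => r _.
  by rewrite /= mulrA.
rewrite exchange_big /=; apply: eq_bigr => r _.
by rewrite -big_distrl /= IH mulrA.
Qed.

End Transfer.

(** For fixed multiplicities the two rows are independent: the joint matrices are tensor products up
    to the scalars [e x]. *)
Lemma transfer_pair (C : comNzRingType) (T U : finType) (e : nat -> C)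
    (w : nat -> T -> T -> C) (w' : nat -> U -> U -> C) t0 u0 L t u :
  transfer (fun x r r' => e x * w x r.1 r'.1 * w' x r.2 r'.2)
    (t0, u0) L (t, u) =
  \prod_(x < L) e x * transfer w t0 L t * transfer w' u0 L u.
Proof.
elim: L t u => [|L IH] t u /=.
  by rewrite big_ord0 mul1r xpair_eqE -natrM mulnb.
rewrite big_ord_recr /= -mulrA big_distrlr pair_big big_distrr /=.
apply: eq_bigr => -[t1 u1] _ /=; rewrite IH.
by ring.
Qed.

(** Neither index set need contain the other; both sums are extended to the union. *)
Lemma fsum_supp (C : nmodType) (T : choiceType) (A : set T) (r : seq T)
    (f : T -> C) : uniq r ->
  (forall i, A i -> i \notin r -> f i = 0) ->
  (forall i, i \in r -> ~ A i -> f i = 0) ->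
  \sum_(i \in A) f i = \sum_(i <- r) f i.
Proof.
move=> ru fA fr; rewrite [RHS]fsbig_seq //.
transitivity (\sum_(i \in A `|` [set` r]) f i).
  apply: fsbig_widen; first exact: subsetUl.
  move=> i [iU nAi]; apply: fr => //.
  by case: iU => // Ai; case: nAi.
apply/esym/fsbig_widen; first exact: subsetUr.
move=> i [iU /negP nir]; apply: fA => //.
by case: iU => // ir; rewrite ir in nir.
Qed.

(** * One row of paths as a matrix product *)

Section Weight.
Variables (C : fieldType) (q u s : C).
Implicit Types (i : nat) (j : int).

Lemma weight_conserv i1 j1 i2 j2 :
  j2 != i1%:Z + j1 - i2%:Z -> weight q u s i1 j1 i2 j2 = 0.
Proof.
move=> nj; rewrite /weight.
by do 4 (case: ifP => [/and3P[/eqP e1 /eqP e2 /eqP e3]|_];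
  first by exfalso; lia).
Qed.

Lemma weight_in_edge i1 j1 i2 j2 :
  j1 != 0 -> j1 != 1 -> weight q u s i1 j1 i2 j2 = 0.
Proof. by move=> /negbTE j0 /negbTE j1'; rewrite /weight j0 j1'. Qed.

Lemma weight_out_edge i1 j1 i2 j2 :
  j2 != 0 -> j2 != 1 -> weight q u s i1 j1 i2 j2 = 0.
Proof. by move=> /negbTE j0 /negbTE j1'; rewrite /weight j0 j1' !andbF. Qed.

End Weight.

Lemma hedge_sum (h0 : int) mu la L :
  hedge h0 mu la L =
  h0 + (\sum_(x < L) mult x la)%N%:Z - (\sum_(x < L) mult x mu)%N%:Z.
Proof.
elim: L => [|L IH] /=; first by rewrite !big_ord0 addr0 subr0.
by rewrite IH !big_ord_recr /= !PoszD; ring.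
Qed.

Lemma hedge_end (h0 : int) mu la L : parts_lt L la -> parts_lt L mu ->
  hedge h0 mu la L = h0 + (len la)%:Z - (len mu)%:Z.
Proof.
by move=> laL muL; rewrite hedge_sum -!len_sum_mult.
Qed.

Section Row.
Variables (C : fieldType) (q u : C) (Xi S : nat -> C).

Definition row_step (la mu : signature) (x : nat) (h h' : bool) : C :=
  vertex q (Xi x * u) (S x) (mult x la) h (mult x mu) h'.

(** Conservation determines every edge from [h0], so at most one sequence of intermediate states
    contributes, namely [hedge]. If [hedge] leaves [{0, 1}], both sides vanish. *)
Lemma transfer_row (h0 : bool) mu la L (h : bool) :
  transfer (row_step la mu) h0 L h =
  if hedge h0 mu la L == h then
    \prod_(x < L) weight q (Xi x * u) (S x) (mult x la) (hedge h0 mu la x)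
                         (mult x mu) (hedge h0 mu la x.+1)
  else 0.
Proof.
elim: L h => [|L IH] h /=.
  by rewrite big_ord0 eq_sym eqz_nat; case: h h0 => [] [].
rewrite big_bool /= !IH big_ord_recr /= /row_step /vertex.
set e := hedge h0 mu la L; set P := \prod_(_ < L) _.
case: (eqVneq e 1) => [->|e1].
  rewrite mul0r addr0; case: eqP => [->//|/eqP ne].
  by rewrite weight_conserv ?mulr0 // eq_sym.
case: (eqVneq e 0) => [->|e0].
  rewrite mul0r add0r; case: eqP => [->//|/eqP ne].
  by rewrite weight_conserv ?mulr0 // eq_sym.
by rewrite !mul0r addr0 weight_in_edge // mulr0 if_same.
Qed.

Hypothesis den : forall x, 1 - S x * Xi x * u != 0.

(** The condition on the lengths says that [hedge] is [0] at column [L]. It then stays [0], and the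
    factors beyond are [1] as their denominators are nonzero. *)
Lemma row_weight_transfer (h0 : bool) mu la L :
  parts_lt L la -> parts_lt L mu ->
  (if len mu == (len la + h0)%N then row_weight h0 q Xi S u mu la else 0) =
  transfer (row_step la mu) h0 L false.
Proof.
move=> laL muL; rewrite transfer_row hedge_end //.
have -> : (h0%:Z + (len la)%:Z - (len mu)%:Z == false)
    = (len mu == (len la + h0)%N).
  by apply/eqP/eqP; lia.
case: eqP => // lE.
have hend x : (L <= x)%N -> hedge h0 mu la x = 0.
  move=> Lx; rewrite (@hedge_end _ _ _ x) ?(parts_ltW Lx) //; lia.
rewrite /row_weight; case: asboolP => [_|nh].
  rewrite [RHS](fsbig_ord _ L (fun x => weight q (Xi x * u) (S x) (mult x la)
    (hedge h0 mu la x) (mult x mu) (hedge h0 mu la x.+1))).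
  apply/esym/fsbig_widen => // x [_ /negP].
  rewrite /= -leqNgt => Lx.
  rewrite /preimage /= -[_ + _ - _]/(hedge h0 mu la x.+1) !hend ?(leqW Lx) //.
  rewrite !(@mult_ge L) // /weight /= expr0 mulr1 mulrA divff //.
(* An edge outside [{0, 1}] occurs at some [x <= L], and not at [x = 0] because [h0] is boolean. The
   vertex that emits it has weight [0]. *)
have [x /not_orP[/eqP h0x /eqP h1x]] := (existsNP _).2 nh.
have xL : (x <= L)%N.
  by rewrite leqNgt; apply: contra h0x => Lx; rewrite hend // ltnW.
case: x h0x h1x xL => [|x] h0x h1x xL.
  by move: h0x h1x; rewrite /=; case: (h0).
by rewrite (bigD1 (Ordinal xL)) //= weight_out_edge // mul0r.
Qed.

Lemma F_transfer mu la L : parts_lt L la -> parts_lt L mu ->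
  F q Xi S u mu la = transfer (row_step la mu) true L false.
Proof. by move=> laL muL; rewrite -row_weight_transfer // /F addn1. Qed.

Lemma G_transfer mu la L : parts_lt L la -> parts_lt L mu ->
  G q Xi S u mu la = transfer (row_step la mu) false L false.
Proof. by move=> laL muL; rewrite -row_weight_transfer // /G addn0. Qed.

(** The edge entering column [L] is [1] plus the number of parts of [la] below [L] minus [len mu].
    It is nonnegative and [len mu = len la + 1], so all parts of [la] are below [L]. *)
Lemma F_parts mu la L : F q Xi S u mu la != 0 -> parts_lt L mu -> parts_lt L la.
Proof.
rewrite /F /row_weight; case: ifP => [/eqP lE|_]; last by rewrite eqxx.
case: asboolP => [hx _ muL|_]; last by rewrite eqxx.
have [K laK] := ex_parts_lt la; pose L' := maxn L K.
have laL' : parts_lt L' la by apply: parts_ltW laK; exact: leq_maxr.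
have LL' : (L <= L')%N by rewrite leq_maxl.
have muE : len mu = (\sum_(x < L) mult x mu)%N by rewrite -len_sum_mult.
have laE := len_sum_mult laL'.
have := hx L; rewrite hedge_sum -muE => hL.
have laLE : (\sum_(x < L') mult x la <= \sum_(x < L) mult x la)%N by lia.
apply/allP => y yla; rewrite ltnNge; apply/negP => Ly.
have yL' : (y < L')%N by apply: (allP laL').
have : (0 < mult y la)%N by rewrite /mult -has_count has_pred1.
move: laLE; rewrite -!(big_mkord xpredT (fun x => mult x la)).
rewrite (big_cat_nat (n := L)) //= (big_cat_nat (m := L) (n := y)) //=;
  last exact: ltnW.
rewrite (big_ltn yL'); lia.
Qed.

End Row.

Lemma c_prod (C : fieldType) (q : C) (S : nat -> C) nu L : parts_lt L nu ->
  c q S nu = \prod_(x < L) mult_factor q (S x) (mult x nu).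
Proof.
move=> nuL; rewrite /c.
rewrite [RHS](fsbig_ord _ L (fun x => mult_factor q (S x) (mult x nu))).
apply/esym/fsbig_widen => // x [_ /negP].
rewrite /= -leqNgt => Lx; rewrite /preimage /= (@mult_ge L) //.
by rewrite /mult_factor /qpoch !big_ord0 divr1.
Qed.

(** * Both sides of the identity as entries of state vectors *)

Section Cauchy.
Variables (C : fieldType) (q u v : C) (Xi S : nat -> C).
Hypotheses (Xi0 : forall j, Xi j != 0)
  (den_u : forall j, 1 - S j * Xi j * u != 0)
  (den_v : forall j, 1 - S j * (Xi j)^-1 * v != 0)
  (den_q : forall i : nat, 1 - q ^+ i.+1 != 0)
  (den_S : forall j i : nat, 1 - S j ^+ 2 * q ^+ i != 0).
Variables la nu : signature.

(** The successor gives the strict bounds on multiplicities required by [yang_baxter]. *)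
Local Notation M := (maxn (len la) (len nu)).+1.

(** The vector [l_L]: the [F]-row leads from [nu] to [kappa], the [G]-row from [la] to [kappa]. *)
Definition upper_state := transfer (fun x =>
  upper_transfer q (Xi x * u) ((Xi x)^-1 * v) (S x) M (mult x nu) (mult x la))
  (true, false).

(** The vector [r_L]: the [F]-row leads from [mu] to [la], the [G]-row from [mu] to [nu]. *)
Definition lower_state := transfer (fun x =>
  lower_transfer q (Xi x * u) ((Xi x)^-1 * v) (S x) M (mult x nu) (mult x la))
  (true, false).

Lemma mult_ltM x : (mult x nu < M)%N /\ (mult x la < M)%N.
Proof.
rewrite !ltnS /mult; split; apply: leq_trans (count_size _ _) _.
  exact: leq_maxr.
exact: leq_maxl.
Qed.

Lemma upper_lower_state L :
  (1 - u * v) * upper_state L (false, false)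
    + (1 - q) * upper_state L (true, true)
  = (1 - q * u * v) * lower_state L (false, false).
Proof.
have uvE x : Xi x * u * ((Xi x)^-1 * v) = u * v.
  by rewrite mulrACA divff // mul1r.
have -> : (1 - q * u * v) * lower_state L (false, false) =
    \sum_t upper_state L t * cross q u v t (false, false).
  apply/esym/transfer_intertwine; last first.
    by case=> [[] []]; rewrite /= ?mulr0 ?mulr1 ?mulrA.
  move=> x t t'; have [aM bM] := mult_ltM x.
  have crE t1 t2 : cross q u v t1 t2 = cross q (Xi x * u) ((Xi x)^-1 * v) t1 t2.
    by rewrite /cross uvE.
  under eq_bigr => r _ do rewrite crE.
  under [RHS]eq_bigr => r _ do rewrite crE.
  by apply: yang_baxter => //; rewrite ?mulrA.
rewrite sum_pair_bool /= !mulr0 addr0 add0r addrC.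
by congr (_ + _); rewrite mulrC.
Qed.

(** When no path enters column [L] from below, an occupied outgoing edge must continue an occupied
    incoming one. Hence [(true, true)] is reached only from itself, with [m = 0]. *)
Lemma upper_state_tail L : parts_lt L la -> parts_lt L nu ->
  upper_state L.+1 (true, true)
  = upper_state L (true, true) * column_ratio Xi S u v L.
Proof.
move=> laL nuL; rewrite {1}/upper_state /= -/upper_state !(@mult_ge L) //.
have upE t :
   upper_transfer q (Xi L * u) ((Xi L)^-1 * v) (S L) M 0 0 t (true, true) =
   if t == (true, true) then column_ratio Xi S u v L else 0.
  rewrite /upper_transfer (eq_bigr (fun m : 'I_M.+1 =>
    vertex q (Xi L * u) (S L) 0 t.1 m true *
    (mult_factor q (S L) m / mult_factor q (S L) 0
       * vertex q ((Xi L)^-1 * v) (S L) 0 t.2 m true))); last first.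
    by move=> m _; rewrite mulrCA mulrA.
  rewrite (sum_vertex_out _ _ _ _ _ (fun m =>
     mult_factor q (S L) m / mult_factor q (S L) 0
       * vertex q ((Xi L)^-1 * v) (S L) 0 t.2 m true)) //.
  case: t => [[] []] //=; rewrite /vertex /weight /= ?mulr0 //.
  rewrite divff ?mult_factor_neq0 // mul1r /column_ratio expr0 !mulr1.
  by rewrite !mulrA.
under eq_bigr => t _ do rewrite upE.
by rewrite sum_pair_bool /= !mulr0 !addr0.
Qed.

(** [Gc] vanishes unless [kappa] has the length of [la], so the sum does not depend on [N], and the
    signatures of other lengths in [enum_sig] add nothing. The box allows parts equal to [L], hence
    the index [L.+1]. *)
Lemma upper_state_sum N L : parts_lt L.+1 la -> parts_lt L.+1 nu ->
  (len la <= N)%N ->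
  \sum_(kappa \in sign_box N L)
    (Gc q (fun j => (Xi j)^-1) S v kappa la * F q Xi S u kappa nu) =
  upper_state L.+1 (false, false).
Proof.
move=> laL nuL laN.
rewrite (@fsum_supp _ _ _ (enum_sig M L.+1)); first last.
- move=> ka kaL kaN; rewrite /Gc /G.
  case: eqP => [le|]; last by rewrite mulr0 mul0r.
  exfalso; apply: kaN; split; first by rewrite le.
  by apply/allP => x /(allP (enum_sig_parts kaL)).
- move=> ka [_ kaL] kaM; rewrite /Gc /G.
  case: eqP => [le|]; last by rewrite mulr0 mul0r.
  case/negP: kaM; apply: mem_enum_sig.
    by apply/allP => x /(allP kaL).
  by rewrite le leqW // leq_maxl.
- exact: enum_sig_uniq.
rewrite /upper_state /upper_transfer -(sum_enum_sig_transfer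
  (fun x m t t' =>
  mult_factor q (S x) m / mult_factor q (S x) (mult x la)
    * vertex q (Xi x * u) (S x) (mult x nu) t.1 m t'.1
    * vertex q ((Xi x)^-1 * v) (S x) (mult x la) t.2 m t'.2)).
apply: eq_big_seq => ka /enum_sig_parts kaL.
rewrite (transfer_pair (fun x => mult_factor q (S x) (mult x ka) /
    mult_factor q (S x) (mult x la)) (row_step q u Xi S nu ka)
  (row_step q v (fun j => (Xi j)^-1) S la ka)).
rewrite -(F_transfer q den_u) // -(G_transfer q den_v) //.
by rewrite prodf_div -!c_prod // /Gc mulrAC.
Qed.

Lemma lower_term_parts mu L : parts_lt L la ->
  F q Xi S u la mu * Gc q (fun j => (Xi j)^-1) S v nu mu != 0 ->
  parts_lt L mu /\ (len mu <= M)%N.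
Proof.
move=> laL; rewrite mulf_eq0 negb_or => /andP[F0 G0]; split.
  exact: F_parts F0 laL.
move: F0; rewrite /F; case: ifP => [/eqP le _|_]; last by rewrite eqxx.
by rewrite leqW // leq_max le leqnSn.
Qed.

(** By [lower_term_parts] all nonzero terms are indexed by [enum_sig M L]. *)
Lemma lower_state_sum L : parts_lt L la -> parts_lt L nu ->
  \sum_(mu \in [set: signature])
    (F q Xi S u la mu * Gc q (fun j => (Xi j)^-1) S v nu mu) =
  lower_state L (false, false).
Proof.
move=> laL nuL.
rewrite (@fsum_supp _ _ _ (enum_sig M L)) //; first last.
- by move=> mu _ [].
- move=> mu _ nmu; apply/eqP; apply: contraNT nmu.
  move=> /(lower_term_parts laL)[muL muM].
  exact: mem_enum_sig.
- exact: enum_sig_uniq.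
rewrite /lower_state /lower_transfer -(sum_enum_sig_transfer
  (fun x m t t' =>
  mult_factor q (S x) (mult x nu) / mult_factor q (S x) m
    * vertex q (Xi x * u) (S x) m t.1 (mult x la) t'.1
    * vertex q ((Xi x)^-1 * v) (S x) m t.2 (mult x nu) t'.2)).
apply: eq_big_seq => mu /enum_sig_parts muL.
rewrite (transfer_pair (fun x => mult_factor q (S x) (mult x nu) /
    mult_factor q (S x) (mult x mu)) (row_step q u Xi S mu la)
  (row_step q v (fun j => (Xi j)^-1) S mu nu)).
rewrite -(F_transfer q den_u) // -(G_transfer q den_v) //.
by rewrite prodf_div -!c_prod // /Gc mulrCA mulrA.
Qed.

(** Solving [upper_lower_state] for the [(false, false)] entry isolates the error term, a multiple
    of the [(true, true)] entry. *)
Lemma upper_state_limit_defect L : 1 - u * v != 0 ->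
  parts_lt L la -> parts_lt L nu ->
  upper_state L (false, false) =
  (1 - q * u * v) / (1 - u * v) * \sum_(mu \in [set: signature])
    (F q Xi S u la mu * Gc q (fun j => (Xi j)^-1) S v nu mu)
  - (1 - q) / (1 - u * v) * upper_state L (true, true).
Proof.
move=> duv laL nuL; rewrite (lower_state_sum laL nuL) mulrAC.
rewrite -upper_lower_state mulrDl ![_ * upper_state L _ / _]mulrAC.
by rewrite addrK divff // mul1r.
Qed.

End Cauchy.

(** * Passage to the limit *)

(** A nonzero factor [r n] can be divided out of the product. If [r n = 0], the longer product
    carries no information on the tail, and the second hypothesis supplies its decay. *)
Lemma prod_tail_cvg0 (K : numFieldType) (r : nat -> K) (n : nat) :
  (\prod_(0 <= j < L.+1) `|r j|) @[L --> \oo] --> (0 : K^o) ->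
  (forall j0, r j0 = 0 ->
    (\prod_(j0.+1 <= j < L.+1) `|r j|) @[L --> \oo] --> (0 : K^o)) ->
  (\prod_(n <= j < L.+1) r j) @[L --> \oo] --> (0 : K^o).
Proof.
move=> r0 rdeg; apply: norm_cvg0.
under eq_fun => L do rewrite normr_prod.
elim: n => [//|n IH].
have [/rdeg//|rn] := eqVneq (r n) 0.
rewrite -[0](mulr0 `|r n|^-1).
apply: cvg_trans (cvgMl_tmp (a := `|r n|^-1) IH).
apply: near_eq_cvg; near=> L.
rewrite [in LHS](@big_ltn _ _ _ n) ?mulKf ?normr_eq0 //.
by rewrite ltnS; near: L; exact: nbhs_infty_ge.
Unshelve. all: by end_near.
Qed.

Lemma affine_cvg (K : numFieldType) (a b : K) (f : nat -> K) :
  f L @[L --> \oo] --> (0 : K^o) -> (a - b * f L) @[L --> \oo] --> (a : K^o).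
Proof.
move=> f0; rewrite -[X in _ --> X]subr0 -(mulr0 b).
apply: (@cvgB K K^o _ _ _ (fun=> a) (fun L => b * f L)).
  exact: cvg_cst.
exact: cvgMl_tmp f0.
Qed.

Theorem proposition4p8 (R : realType) (q : R[i]%C) (Xi S : nat -> R[i]%C)
    (u v : R[i]%C)
    (q_neq0 : q <> 0)
    (Xi_neq0 : forall j, Xi j <> 0)
    (S_neq0 : forall j, S j <> 0)
    (den_u : forall j, 1 - S j * Xi j * u <> 0)
    (den_v : forall j, 1 - S j * (Xi j)^-1 * v <> 0)
    (den_q : forall i : nat, 1 - q ^+ i.+1 <> 0)
    (den_S : forall (j i : nat), 1 - S j ^+ 2 * q ^+ i <> 0)
    (den_uv : 1 - u * v <> 0)
    (lim_uv : (\prod_(0 <= j < L.+1) `|column_ratio Xi S u v j|) @[L --> \oo]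
                --> (0 : (R[i]%C)^o))
    (lim_uv_degenerate : forall j0 : nat, column_ratio Xi S u v j0 = 0 ->
       (\prod_(j0.+1 <= j < L.+1) `|column_ratio Xi S u v j|) @[L --> \oo]
                --> (0 : (R[i]%C)^o))
    (la nu : signature) :
  finite_set [set mu : signature |
    F q Xi S u la mu * Gc q (fun j => (Xi j)^-1) S v nu mu != 0] /\
  sign_series
    (fun kappa => Gc q (fun j => (Xi j)^-1) S v kappa la * F q Xi S u kappa nu)
    ((1 - q * u * v) / (1 - u * v) *
     \sum_(mu \in [set: signature])
        (F q Xi S u la mu * Gc q (fun j => (Xi j)^-1) S v nu mu)).
Proof.
have Xi0 j : Xi j != 0 by exact/eqP.
have du j : 1 - S j * Xi j * u != 0 by exact/eqP.
have dv j : 1 - S j * (Xi j)^-1 * v != 0 by exact/eqP.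
have dq i : 1 - q ^+ i.+1 != 0 by exact/eqP.
have dS j i : 1 - S j ^+ 2 * q ^+ i != 0 by exact/eqP.
have duv : 1 - u * v != 0 by exact/eqP.
have [L1 laL1] := ex_parts_lt la; have [L2 nuL2] := ex_parts_lt nu.
pose L0 := maxn L1 L2.
have laL L : (L0 <= L)%N -> parts_lt L la.
  by move=> L0L; apply: parts_ltW laL1; exact: leq_trans (leq_maxl _ _) L0L.
have nuL L : (L0 <= L)%N -> parts_lt L nu.
  by move=> L0L; apply: parts_ltW nuL2; exact: leq_trans (leq_maxr _ _) L0L.
split.
  apply: (@sub_finite_set _ _
    [set` enum_sig (maxn (len la) (len nu)).+1 L0]); last exact: finite_seq.
  move=> mu /= /(lower_term_parts (laL _ (leqnn _)))[muL muM].
  exact: mem_enum_sig.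
pose U L t := upper_state q u v Xi S la nu L t.
have U11 L : (L0 <= L)%N -> U L (true, true) =
    U L0 (true, true) * \prod_(L0 <= j < L) column_ratio Xi S u v j.
  elim: L => [|L IH] L0L.
    by move: L0L; rewrite leqn0 => /eqP ->; rewrite big_geq // mulr1.
  move: L0L; rewrite leq_eqVlt => /orP[/eqP <-|L0L].
    by rewrite big_geq // mulr1.
  rewrite /U upper_state_tail ?laL ?nuL // -/(U L _) IH //.
  by rewrite big_nat_recr //= mulrA.
have U11_cvg : U L.+1 (true, true) @[L --> \oo] --> (0 : (R[i]%C)^o).
  have := prod_tail_cvg0 L0 lim_uv lim_uv_degenerate.
  move=> /(cvgMl_tmp (a := U L0 (true, true))); rewrite mulr0.
  apply: cvg_trans; apply: near_eq_cvg; near=> L.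
  have L0L : (L0 <= L)%N by near: L; exact: nbhs_infty_ge.
  by rewrite [RHS]U11 ?leqW.
set s := \sum_(mu \in _) _.
have U00 L : (L0 <= L)%N -> U L.+1 (false, false) =
    (1 - q * u * v) / (1 - u * v) * s
    - (1 - q) / (1 - u * v) * U L.+1 (true, true).
  by move=> L0L; apply: upper_state_limit_defect; rewrite ?laL ?nuL ?leqW.
rewrite /sign_series.
have U00_cvg : U p.2.+1 (false, false) @[p --> (\oo, \oo)] -->
    ((1 - q * u * v) / (1 - u * v) * s : (R[i]%C)^o).
  (* The double limit reduces to a limit in [L] alone, since [U] does not involve [N]. *)
  apply: (@cvg_comp _ _ _ snd (fun L => U L.+1 (false, false)) _ \oo).
    exact: cvg_snd.
  have lim := @affine_cvg _ ((1 - q * u * v) / (1 - u * v) * s)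
    ((1 - q) / (1 - u * v)) _ U11_cvg.
  apply: (cvg_trans _ lim); apply: near_eq_cvg; near=> L.
  have L0L : (L0 <= L)%N by near: L; exact: nbhs_infty_ge.
  by rewrite U00.
apply: cvg_trans U00_cvg; apply: near_eq_cvg.
(* From these thresholds on, the partial sum over the box equals the entry of [U]. *)
exists ([set N | (len la <= N)%N], [set L | (L0 <= L)%N]) => /=.
  by split; exact: nbhs_infty_ge.
move=> [N L] /= [laN L0L].
by rewrite upper_state_sum ?laL ?nuL ?leqW.
Unshelve. all: by end_near.
Qed.
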